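(* Let $R$ be a regular Noetherian commutative ring of dimension $2$ and let $P_0$ be a finitely generated projective $R$-module of constant rank $2$. Then $E_\infty(P_0)\cap Aut(P_4)=E(P_4)$.
   Context: For $n\ge3$, $P_n=P_0\oplus Re_3\oplus\dots\oplus Re_n$ with $Re_i$ free of rank $1$ on $e_i$. For $M=\bigoplus_i M_i$, $E(M)\subset Aut(M)$ is generated by the automorphisms $id_M+s$ with $s:M_j\to M_i$ linear, $i\ne j$; $E(P_n)$ is taken with respect to $P_0,Re_3,\dots,Re_n$. Via $\varphi\mapsto\varphi\oplus id$, $Aut(P_n)\subset Aut(P_{n+1})$ and $E(P_n)\subset E(P_{n+1})$; $E_\infty(P_0)=\varinjlim E(P_n)$ inside $Aut_\infty(P_0)=\varinjlim Aut(P_n)$, where the intersection is taken. *)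

(* Defs.v *)
From HB Require Import structures.
From mathcomp Require Import all_boot all_order all_algebra ring.
From mathcomp Require Import boolp classical_sets.

Set Implicit Arguments.
Unset Strict Implicit.
Unset Printing Implicit Defensive.

Import GRing.Theory.

Local Open Scope classical_set_scope.
Local Open Scope quotient_scope.
Local Open Scope ring_scope.

Section Ideals.
Variable R : comPzRingType.
Implicit Types I J p : set R.

Definition is_ideal I :=
  [/\ I 0, forall x y, I x -> I y -> I (x + y) & forall a x, I x -> I (a * x)].

Definition is_prime p :=
  [/\ is_ideal p, ~ p 1 & forall a b, p (a * b) -> p a \/ p b].

Definition is_maximal p :=
  [/\ is_ideal p, ~ p 1 & forall J, is_ideal J -> ~ J 1 -> p `<=` J -> J = p].

Definition generated_by n (g : 'I_n -> R) : set R :=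
  [set x | exists a : 'I_n -> R, x = \sum_(i < n) a i * g i].

Definition noetherian := forall I, is_ideal I ->
  exists n (g : 'I_n -> R), I = generated_by g.

(* n counts the strict inclusions p_0 < p_1 < ... < p_n *)
Definition prime_chain n (p : 'I_n.+1 -> set R) :=
  (forall i, is_prime (p i)) /\ (forall i j : 'I_n.+1, (i < j)%N -> p i `<` p j).

Definition krull_dim n :=
  (exists p : 'I_n.+1 -> set R, prime_chain p) /\
  (forall m (p : 'I_m.+1 -> set R), prime_chain p -> (m <= n)%N).

Definition min_generators I n :=
  (exists g : 'I_n -> R, I = generated_by g) /\
  (forall m (g : 'I_m -> R), I = generated_by g -> (n <= m)%N).

Definition regular_local := noetherian /\
  exists m : set R, [/\ is_maximal m, forall m', is_maximal m' -> m' = m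
    & exists d, krull_dim d /\ min_generators m d].

End Ideals.

Record mulset (R : comPzRingType) := MulSet {
  mulset_set :> set R;
  mulset1 : mulset_set 1;
  mulsetM : forall s t, mulset_set s -> mulset_set t -> mulset_set (s * t)
}.

Section Localization.
Variables (R : comPzRingType) (S : mulset R).

Definition den (s : set_type S) : R := \val s.

Lemma denP (s : set_type S) : mulset_set S (den s). Proof. exact: set_valP. Qed.

Definition mkden (s : R) (hs : mulset_set S s) : set_type S :=
  exist (fun x => x \in (S : set R)) s (mem_set hs).
Definition den1 := mkden (mulset1 S).
Definition denM (s t : set_type S) := mkden (mulsetM (denP s) (denP t)).

Lemma denME s t : den (denM s t) = den s * den t. Proof. by []. Qed.
Lemma den1E : den den1 = 1. Proof. by []. Qed.

Section Module.
Variable M : lmodType R.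
Local Notation frac := (M * set_type S)%type.

Definition frac_eq (a b : frac) : bool :=
  `[< exists u : set_type S,
        (den u * den b.2) *: a.1 = (den u * den a.2) *: b.1 >].

Lemma frac_eq_refl : reflexive frac_eq.
Proof. by move=> a; apply/asboolP; exists den1. Qed.

Lemma frac_eq_sym : symmetric frac_eq.
Proof. by move=> a b; apply/asboolP/asboolP => -[u e]; exists u. Qed.

Lemma frac_eq_trans : transitive frac_eq.
Proof.
move=> b a c /asboolP[u e] /asboolP[v f]; apply/asboolP.
exists (denM (denM u v) b.2); rewrite !denME.
rewrite (_ : _ * den c.2 = (den v * den c.2) * (den u * den b.2)); last by ring.
rewrite -scalerA e scalerA.
rewrite (_ : _ * _ = (den u * den a.2) * (den v * den c.2)); last by ring.
by rewrite -scalerA f scalerA; congr (_ *: _); ring.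
Qed.

Canonical frac_equiv := EquivRel frac_eq frac_eq_refl frac_eq_sym frac_eq_trans.

Definition locmod := {eq_quot frac_eq}.
HB.instance Definition _ := EqQuotient.on locmod.
HB.instance Definition _ := Choice.on locmod.

Lemma locmodP (a b : frac) : reflect
  (exists u : set_type S, (den u * den b.2) *: a.1 = (den u * den a.2) *: b.1)
  (a == b %[mod locmod]).
Proof. by rewrite eqmodE; apply: asboolP. Qed.

Lemma locmod_repr (a : frac) : exists u : set_type S,
  let b := repr (\pi_locmod a) in
  (den u * den a.2) *: b.1 = (den u * den b.2) *: a.1.
Proof. by apply/locmodP; rewrite reprK. Qed.

Definition addf (a b : frac) : frac :=
  (den b.2 *: a.1 + den a.2 *: b.1, denM a.2 b.2).
Definition oppf (a : frac) : frac := (- a.1, a.2).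

Definition addl := lift_op2 locmod addf.
Definition oppl := lift_op1 locmod oppf.
Definition zerol : locmod := \pi_locmod (0, den1).

Lemma pi_addl : {morph \pi_locmod : a b / addf a b >-> addl a b}.
Proof.
move=> a b; unlock addl; apply/eqP/locmodP.
have [u e] := locmod_repr a; have [v f] := locmod_repr b.
set a' := repr _ in e *; set b' := repr _ in f *; rewrite /= in e f.
exists (denM u v); rewrite /addf /= !denME !scalerDr !scalerA; congr (_ + _).
  rewrite (_ : _ * _ = (den v * den b.2 * den b'.2) * (den u * den a'.2));
    last by ring.
  by rewrite -scalerA -e scalerA; congr (_ *: _); ring.
rewrite (_ : _ * _ = (den u * den a.2 * den a'.2) * (den v * den b'.2));
  last by ring.
by rewrite -scalerA -f scalerA; congr (_ *: _); ring.
Qed.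
Canonical pi_addl_morph := PiMorph2 pi_addl.

Lemma pi_oppl : {morph \pi_locmod : a / oppf a >-> oppl a}.
Proof.
move=> a; unlock oppl; apply/eqP/locmodP.
have [u e] := locmod_repr a; exists u.
by rewrite /= in e *; rewrite !scalerN e.
Qed.
Canonical pi_oppl_morph := PiMorph1 pi_oppl.

Lemma addlA : associative addl.
Proof.
elim/quotW=> a; elim/quotW=> b; elim/quotW=> c; rewrite !piE.
apply/eqP/locmodP; exists den1; rewrite /addf /= !denME !scalerDr !scalerA.
by rewrite !addrA; congr (_ + _ + _); congr (_ *: _); ring.
Qed.

Lemma addlC : commutative addl.
Proof.
elim/quotW=> a; elim/quotW=> b; rewrite !piE; apply/eqP/locmodP.
exists den1; rewrite /addf /= !denME addrC.
by congr (_ *: _); ring.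
Qed.

Lemma add0l : left_id zerol addl.
Proof.
elim/quotW=> a; rewrite /zerol !piE; apply/eqP/locmodP; exists den1.
by rewrite /addf /= !denME !den1E scaler0 add0r !scalerA; congr (_ *: _); ring.
Qed.

Lemma addNl : left_inverse zerol oppl addl.
Proof.
elim/quotW=> a; rewrite /zerol !piE; apply/eqP/locmodP; exists den1.
by rewrite /addf /oppf /= scalerN addNr !scaler0.
Qed.

HB.instance Definition _ := GRing.isZmodule.Build locmod addlA addlC add0l addNl.

Lemma addlE (a b : frac) :
  \pi_locmod a + \pi_locmod b = \pi_locmod (addf a b).
Proof. by rewrite pi_addl. Qed.

End Module.

Section Action.
Variable M : lmodType R.

Definition actf (r : R^o * set_type S) (a : M * set_type S) :=
  ((r.1 : R) *: a.1, denM r.2 a.2).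

Definition actl (r : locmod R^o) (a : locmod M) : locmod M :=
  \pi_(locmod M) (actf (repr r) (repr a)).

Lemma actlE r a : actl (\pi_(locmod R^o) r) (\pi_(locmod M) a) =
  \pi_(locmod M) (actf r a).
Proof.
rewrite /actl; apply/eqP/locmodP.
have [u e] := locmod_repr r; have [v f] := locmod_repr a.
set r' := repr _ in e *; set a' := repr _ in f *; rewrite /= in e f.
have {}e : den u * den r.2 * r'.1 = den u * den r'.2 * r.1 := e.
exists (denM u v); rewrite /actf /= !denME !scalerA.
rewrite (_ : _ * _ = (den u * den r.2 * r'.1) * (den v * den a.2)); last by ring.
by rewrite e -scalerA f scalerA; congr (_ *: _); ring.
Qed.

Definition onel : locmod R^o := \pi_(locmod R^o) (1, den1).

Lemma act1l : left_id onel actl.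
Proof.
elim/quotW=> a; rewrite actlE; apply/eqP/locmodP; exists den1.
by rewrite /actf /= scale1r !denME !den1E; congr (_ *: _); ring.
Qed.

Lemma actlDr r : {morph actl r : a b / a + b}.
Proof.
elim/quotW: r => r; elim/quotW=> a; elim/quotW=> b.
rewrite [in LHS]addlE !actlE addlE; apply/eqP/locmodP; exists den1.
rewrite /actf /addf /= !denME !scalerDr !scalerA.
by congr (_ + _); congr (_ *: _); ring.
Qed.

Lemma actlDl a : {morph actl^~ a : r s / r + s}.
Proof.
elim/quotW: a => a; elim/quotW=> r; elim/quotW=> s.
rewrite [in LHS]addlE !actlE addlE; apply/eqP/locmodP; exists den1.
rewrite /actf /addf /= !denME !scalerDr !scalerA -scalerDl.
congr (_ *: _); rewrite /GRing.scale /=; ring.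
Qed.

End Action.

Lemma actlA (M : lmodType R) r s (a : locmod M) :
  actl r (actl s a) = actl (actl r s) a.
Proof.
elim/quotW: r => r; elim/quotW: s => s; elim/quotW: a => a.
rewrite (actlE s a) (actlE r s) !actlE; apply/eqP/locmodP; exists den1.
rewrite /actf /= !denME !scalerA; congr (_ *: _).
by rewrite -[(r.1 : R) *: s.1]/((r.1 : R) * (s.1 : R)); ring.
Qed.

Lemma actlC : commutative (@actl R^o).
Proof.
elim/quotW=> r; elim/quotW=> s; rewrite !actlE; apply/eqP/locmodP; exists den1.
by rewrite /actf /= !denME /GRing.scale /=; ring.
Qed.

Definition locring := locmod R^o.
HB.instance Definition _ := GRing.Zmodule.on locring.

HB.instance Definition _ := GRing.Zmodule_isComPzRing.Build locring
  (@actlA R^o) actlC (@act1l R^o) (fun r s a => @actlDl R^o a r s).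

HB.instance Definition _ (M : lmodType R) :=
  GRing.Zmodule_isLmodule.Build locring (locmod M)
    (@actlA M) (@act1l M) (@actlDr M) (@actlDl M).

End Localization.

Section Prime.
Variables (R : comPzRingType) (p : set R) (hp : is_prime p).

Lemma prime_compl1 : (~` p) 1. Proof. by case: hp. Qed.

Lemma prime_complM s t : (~` p) s -> (~` p) t -> (~` p) (s * t).
Proof. by case: hp => _ _ h ps pt /h[]. Qed.

Definition prime_compl := MulSet prime_compl1 prime_complM.

End Prime.

Notation loc_ring_at hp := (locring (prime_compl hp)).
Notation loc_mod_at hp M := (locmod (prime_compl hp) M).

Definition regular_ring (R : comPzRingType) := noetherian R /\
  forall (p : set R) (hp : is_prime p), regular_local (loc_ring_at hp).

Section Modules.
Variables (R : comPzRingType) (P : lmodType R).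

Definition finitely_generated := exists n (g : 'I_n -> P),
  forall x, exists a : 'I_n -> R, x = \sum_(i < n) a i *: g i.

Definition projective := forall (M N : lmodType R)
  (f : {linear M -> N}) (g : {linear P -> N}),
  (forall y, exists x, f x = y) ->
  exists h : {linear P -> M}, forall x, f (h x) = g x.

Definition constant_rank r := forall (p : set R) (hp : is_prime p),
  exists f : {linear 'rV[loc_ring_at hp]_r -> loc_mod_at hp P}, bijective f.

End Modules.

Section Aut.
Variables (R : comPzRingType) (M : lmodType R).

Record aut := Aut {
  aut_fun :> M -> M;
  aut_inv : M -> M;
  aut_linear : linear aut_fun;
  aut_funK : cancel aut_fun aut_inv;
  aut_invK : cancel aut_inv aut_fun
}.

Lemma aut_eqP (f g : aut) : f =1 g -> f = g.
Proof.
case: f g => [f f' lf f1 f2] [g g' lg g1 g2] /= /funext e.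
subst g; have e : f' = g' by apply/funext => x; rewrite -{1}(g2 x) f1.
by subst g'; congr Aut; apply: Prop_irrelevance.
Qed.

HB.instance Definition _ := gen_eqMixin aut.
HB.instance Definition _ := gen_choiceMixin aut.

Lemma id_linear : linear (@id M). Proof. by []. Qed.
Definition aut1 := Aut id_linear (frefl id) (frefl id).

Lemma comp_linear (f g : aut) : linear (f \o g).
Proof. by move=> a x y; rewrite /= !aut_linear. Qed.
Definition autM f g := Aut (comp_linear f g)
  (can_comp (aut_funK f) (aut_funK g)) (can_comp (aut_invK g) (aut_invK f)).

Lemma inv_linear (f : aut) : linear (aut_inv f).
Proof.
by move=> a x y; apply: (can_inj (aut_funK f)); rewrite aut_linear !aut_invK.
Qed.
Definition autV f := Aut (inv_linear f) (aut_invK f) (aut_funK f).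

Lemma autMA : associative autM. Proof. by move=> f g h; apply: aut_eqP. Qed.
Lemma aut1M : left_id aut1 autM. Proof. by move=> f; apply: aut_eqP. Qed.
Lemma autM1 : right_id aut1 autM. Proof. by move=> f; apply: aut_eqP. Qed.
Lemma autVM : left_inverse aut1 autV autM.
Proof. by move=> f; apply: aut_eqP => x /=; rewrite aut_funK. Qed.
Lemma autMV : right_inverse aut1 autV autM.
Proof. by move=> f; apply: aut_eqP => x /=; rewrite aut_invK. Qed.

HB.instance Definition _ := isGroup.Build aut autMA aut1M autM1 autVM autMV.

End Aut.

Definition generated_subgroup (G : groupType) (A : set G) : set G :=
  smallest [set H : set G | group_closed [in H]] A.

Record decomposition (R : comPzRingType) (M : lmodType R) := Decomposition {
  dindex : finType;
  summand : dindex -> lmodType R;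
  inj : forall i, {linear summand i -> M};
  proj : forall i, {linear M -> summand i};
  proj_inj : forall i x, proj i (inj i x) = x;
  proj_inj_neq : forall i j x, i != j -> proj i (inj j x) = 0;
  sum_inj_proj : forall x, \sum_i inj i (proj i x) = x
}.

(* id + s for s : M_j -> M_i linear and i != j, s being seen as an
   endomorphism of M through the projection to M_j and the inclusion of M_i *)
Definition elementary (R : comPzRingType) (M : lmodType R)
    (D : decomposition M) : set (aut M) :=
  [set f | exists (i j : dindex D) (s : {linear summand j -> summand i}),
    i != j /\ forall x, f x = x + inj i (s (proj j x))].

Definition elementary_group (R : comPzRingType) (M : lmodType R) (D : decomposition M) :
  set (aut M) := generated_subgroup (elementary D).

Section Stabilization.
Variables (R : comPzRingType) (M N : lmodType R).

Lemma aut_sum_linear (f : aut M) : linear (fun x : M * N => (f x.1, x.2)).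
Proof. by move=> a [x1 x2] [y1 y2] /=; rewrite aut_linear. Qed.

Lemma aut_sumK (f : aut M) : cancel (fun x : M * N => (f x.1, x.2))
  (fun x => (aut_inv f x.1, x.2)).
Proof. by case=> x y /=; rewrite aut_funK. Qed.

Lemma aut_sumVK (f : aut M) : cancel (fun x : M * N => (aut_inv f x.1, x.2))
  (fun x => (f x.1, x.2)).
Proof. by case=> x y /=; rewrite aut_invK. Qed.

(* f (+) id_N *)
Definition aut_sum (f : aut M) : aut (M * N)%type :=
  Aut (aut_sum_linear f) (aut_sumK f) (@aut_sumVK f).

Definition triv_decomp : decomposition M.
Proof.
refine (@Decomposition R M unit (fun _ => M)
  (fun _ => (idfun : {linear M -> M})) (fun _ => (idfun : {linear M -> M}))
  _ _ _).
- by [].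
- by case; case.
- by move=> x; rewrite (big_pred1 tt) => // -[].
Defined.

Section AddSummand.
Variable D : decomposition M.

Definition summand_add (i : option (dindex D)) : lmodType R :=
  if i is Some j then summand j else N.

Definition inj_add_fun (i : option (dindex D)) : summand_add i -> (M * N)%type :=
  match i with Some j => fun x => (inj j x, 0) | None => fun x => (0, x) end.

Definition proj_add_fun (i : option (dindex D)) : (M * N)%type -> summand_add i :=
  match i with Some j => fun x => proj j x.1 | None => fun x => x.2 end.

Lemma inj_add_linear i : linear (@inj_add_fun i).
Proof.
case: i => [j|] a x y /=; congr pair => /=; rewrite ?linearP //.
- by rewrite scaler0 addr0.
- by rewrite scaler0 addr0.
Qed.

Lemma proj_add_linear i : linear (@proj_add_fun i).
Proof. by case: i => [j|] a x y //=; rewrite linearP. Qed.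

HB.instance Definition _ i := GRing.isLinear.Build R (summand_add i)
  (M * N)%type _ (@inj_add_fun i) (@inj_add_linear i).
HB.instance Definition _ i := GRing.isLinear.Build R (M * N)%type
  (summand_add i) _ (@proj_add_fun i) (@proj_add_linear i).

Definition decomp_add : decomposition (M * N)%type.
Proof.
refine (@Decomposition R (M * N)%type (option (dindex D)) summand_add
  (fun i => (@inj_add_fun i : {linear summand_add i -> (M * N)%type}))
  (fun i => (@proj_add_fun i : {linear (M * N)%type -> summand_add i})) _ _ _).
- by case=> [i|] x //=; rewrite proj_inj.
- by case=> [i|] [j|] x //= ij; rewrite ?proj_inj_neq ?linear0.
- case=> x y; rewrite (bigD1 None) //= (reindex_omap Some id) => [|[]//] /=.
  rewrite (eq_bigl predT) => [|i]; last by rewrite eqxx.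
  have hD : {morph (fun u : M => (u, 0) : M * N) : u v / u + v}.
    by move=> u v; congr pair; rewrite addr0.
  rewrite -(big_morph _ hD (erefl : (0, 0) = 0 :> M * N)) sum_inj_proj.
  by congr pair; rewrite ?add0r ?addr0.
Defined.

End AddSummand.
End Stabilization.

Section Stable.
Variables (R : comPzRingType) (P0 : lmodType R).

(* stab k = P_(k + 2) = P_0 (+) R e_3 (+) ... (+) R e_(k + 2) *)
Fixpoint stab (k : nat) : lmodType R :=
  if k is k'.+1 then (stab k' * R^o)%type else P0.

Fixpoint stab_decomp (k : nat) : decomposition (stab k) :=
  match k with
  | 0 => triv_decomp P0
  | k'.+1 => decomp_add R^o (stab_decomp k')
  end.

Definition Estab k : set (aut (stab k)) :=
  elementary_group (stab_decomp k).

Definition level_aut := {k : nat & aut (stab k)}.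

Definition stab_step (a : level_aut) : level_aut :=
  existT (fun k => aut (stab k)) (tag a).+1 (aut_sum R^o (tagged a)).

(* two automorphisms are identified when they become equal at some level *)
Definition stab_eq (a b : level_aut) : bool :=
  `[< exists m n, iter m stab_step a = iter n stab_step b >].

Lemma stab_eq_refl : reflexive stab_eq.
Proof. by move=> a; apply/asboolP; exists 0, 0. Qed.

Lemma stab_eq_sym : symmetric stab_eq.
Proof. by move=> a b; apply/asboolP/asboolP => -[m [n e]]; exists n, m. Qed.

Lemma stab_eq_trans : transitive stab_eq.
Proof.
move=> b a c /asboolP[m [n e]] /asboolP[m' [n' f]]; apply/asboolP.
exists (m' + m)%N, (n + n')%N.
by rewrite iterD e -iterD addnC iterD f -iterD.
Qed.

Canonical stab_equiv := EquivRel stab_eq stab_eq_refl stab_eq_sym stab_eq_trans.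

Definition Aut_infty := {eq_quot stab_eq}.

Definition to_Aut_infty k (f : aut (stab k)) : Aut_infty :=
  \pi_Aut_infty (existT (fun k => aut (stab k)) k f).

(* Aut(P_(k + 2)) and E(P_(k + 2)) as subsets of Aut_infty *)
Definition Aut_level k : set Aut_infty := range (@to_Aut_infty k).
Definition E_level k : set Aut_infty := @to_Aut_infty k @` @Estab k.

Definition E_infty : set Aut_infty := \bigcup_k E_level k.

End Stable.

Arguments Estab {R} P0 k _.
Arguments to_Aut_infty {R} P0 k f.
Arguments Aut_level {R} P0 k _.
Arguments E_level {R} P0 k _.
Arguments E_infty {R} P0 _.

(* Main.v *)
(* Let EG(Q) be the group of automorphisms of Q (+) R generated by the
   transvections (x, z) |-> (x + z v, z) and (x, z) |-> (x, z + f x). As all but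
   one of the summands of P_n are free of rank 1, E(P_(n + 1)) = EG(P_n).

   Injective stability. On (Q (+) R) (+) R, with coordinates (x, y, z), every
   element of EG(Q (+) R) factors as p c q, where q fixes the coordinate z and
   acts through EG(Q) on (x, y), p fixes the vector e_y and acts through EG(Q)
   on (x, z), and c adds a multiple of y to z (the decomposition of Dennis and
   Vaserstein). The product is preserved by the generators as soon as Q
   satisfies the stable range condition. If p c q = g (+) id, then comparing the
   coordinate z forces c = 1, and g is read off p and q as an element of EG(Q).

   Stable range. Let (f, f1) be a functional on P_0 (+) R, unimodular together
   with a. If a frame of P_0 is valid outside V(s), with s outside the minimal
   primes, one makes f nonzero modulo the minimal primes of s, then the first
   coordinate of f nonzero at the minimal primes, then the second one at the
   minimal primes of the first, and finally f1 at the minimal primes of the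
   image of f. A prime containing the new functional but not a would sit on top
   of a chain of four primes. *)
Require Import Defs.
From HB Require Import structures.
From mathcomp Require Import all_boot all_order all_algebra ring.
From mathcomp Require Import boolp classical_sets.

Set Implicit Arguments.
Unset Strict Implicit.
Unset Printing Implicit Defensive.

Import GRing.Theory.

Local Open Scope classical_set_scope.
Local Open Scope quotient_scope.
Local Open Scope ring_scope.

(** * Elementary groups and transvections *)

Section GeneratedSubgroup.
Variables (G : groupType) (A : set G).
Local Notation gen := (generated_subgroup A).

Lemma gen_sub : A `<=` gen. Proof. exact: sub_gen_smallest. Qed.

Lemma gen1 : gen 1%g.
Proof. by move=> H [[H1 _] _]; rewrite inE in H1. Qed.

Lemma genM f g : gen f -> gen g -> gen (f * g)%g.
Proof.
move=> hf hg H /= hH; have [H1 HM] := hH.1.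
have := group_closedM hH.1; move=> /(_ f g); rewrite !inE; apply.
  exact: hf.
exact: hg.
Qed.

Lemma genV f : gen f -> gen (f^-1)%g.
Proof.
move=> hf H /= hH; have := group_closedV hH.1.
by move=> /(_ f); rewrite !inE; apply; apply: hf.
Qed.

Lemma gen_min (H : set G) : H 1%g ->
  (forall f g, H f -> H g -> H (f * g^-1)%g) -> A `<=` H -> gen `<=` H.
Proof.
move=> H1 HM HA; apply: smallest_sub => //=; split; first by rewrite inE.
by move=> f g; rewrite !inE; apply: HM.
Qed.

(* [{h | Y g <-> Y (g h) for all g}] is a subgroup. *)
Lemma gen_min_right (Y : set G) : Y 1%g ->
  (forall g h, Y g -> A h -> Y (g * h)%g) ->
  (forall g, A g -> A (g^-1)%g) -> gen `<=` Y.
Proof.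
move=> Y1 YM AV h hh.
have : forall g, Y g <-> Y (g * h)%g.
  move: h hh; apply: gen_min => [g|f f' hf hf' g|a ha g].
  - by rewrite mulg1.
  - by rewrite hf (hf' (g * (f * f'^-1))%g) -!mulgA mulVg mulg1.
  - by split=> [/YM|/YM/(_ (AV _ ha))]; [apply|rewrite mulgK].
by move=> /(_ 1%g); rewrite mul1g => <-.
Qed.

End GeneratedSubgroup.

Section Linear.
Variable R : comPzRingType.
Implicit Types M N Q : lmodType R.

Definition mklin M N (f : M -> N) (hf : linear f) : {linear M -> N} :=
  HB.pack f (GRing.isLinear.Build R M N *:%R f hf).

Lemma scale_linear M (v : M) : linear (fun r : R^o => (r : R) *: v).
Proof. by move=> a x y; rewrite scalerDl scalerA. Qed.

Lemma inl_linear M N : linear (fun x : M => (x, 0 : N)).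
Proof. by move=> a x y; congr pair; rewrite /= scaler0 addr0. Qed.

Lemma prod_linearE M (f : {linear (M * R^o)%type -> R^o}) x z :
  f (x, z) = f (x, 0) + z * f (0, 1).
Proof.
rewrite -[z * _]/(z *: f (0, 1)) -linearZ -linearD; congr (f _).
congr pair; first by rewrite /= scaler0 addr0.
by rewrite /= add0r [RHS]mulr1.
Qed.

End Linear.

Section Transvections.
Variable R : comPzRingType.

Section Generators.
Variable Q : lmodType R.
Implicit Types (v : Q) (f : {linear Q -> R^o}).

Definition upper_fun v (p : Q * R^o) : Q * R^o := (p.1 + (p.2 : R) *: v, p.2).
Definition lower_fun f (p : Q * R^o) : Q * R^o := (p.1, p.2 + f p.1).

Lemma upper_linear v : linear (upper_fun v).
Proof.
move=> a [x z] [x' z']; congr pair => /=.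
by rewrite scalerDr scalerDl !scalerA addrACA.
Qed.

Lemma lower_linear f : linear (lower_fun f).
Proof.
move=> a [x z] [x' z']; congr pair => /=.
by rewrite linearP scalerDr addrACA.
Qed.

Lemma upperK v : cancel (upper_fun v) (upper_fun (- v)).
Proof. by move=> [x z]; rewrite /upper_fun /= scalerN addrK. Qed.
Lemma upperVK v : cancel (upper_fun (- v)) (upper_fun v).
Proof. by move=> [x z]; rewrite /upper_fun /= scalerN addrNK. Qed.

Lemma lowerK f : cancel (lower_fun f) (fun p => (p.1, p.2 - f p.1)).
Proof. by move=> [x z]; rewrite /lower_fun /= addrK. Qed.
Lemma lowerVK f : cancel (fun p => (p.1, p.2 - f p.1)) (lower_fun f).
Proof. by move=> [x z]; rewrite /lower_fun /= addrNK. Qed.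

Definition upper v : aut (Q * R^o)%type :=
  Aut (upper_linear v) (upperK v) (upperVK v).
Definition lower f : aut (Q * R^o)%type :=
  Aut (lower_linear f) (lowerK f) (@lowerVK f).

Definition transvection : set (aut (Q * R^o)%type) :=
  [set g | (exists v, g = upper v) \/ (exists f, g = lower f)].

(** The group EG(Q); it acts on Q (+) R, not on Q. *)
Definition transvection_group := generated_subgroup transvection.

Lemma transvection_group_upper v : transvection_group (upper v).
Proof. by apply: gen_sub; left; exists v. Qed.
Lemma transvection_group_lower f : transvection_group (lower f).
Proof. by apply: gen_sub; right; exists f. Qed.

Lemma upperV v : ((upper v)^-1)%g = upper (- v).
Proof. by apply: aut_eqP. Qed.

Lemma lowerV f : ((lower f)^-1)%g = lower (-1 \*: f).
Proof.
apply: aut_eqP => -[x z]; rewrite /= /lower_fun /=.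
by rewrite [-1 *: f x]mulN1r.
Qed.

Lemma transvectionV g : transvection g -> transvection (g^-1)%g.
Proof.
by case=> [[v ->]|[f ->]]; [left; exists (- v)|right; exists (-1 \*: f)];
  rewrite ?upperV ?lowerV.
Qed.

End Generators.

End Transvections.
Arguments transvection_group {R} Q _.
Arguments upper {R Q}.
Arguments lower {R Q}.

Section ElementaryGroup.
Variables (R : comPzRingType).

Section General.
Variables (M : lmodType R) (D : decomposition M).
Local Notation E := (elementary_group (decomp_add R^o D)).

Lemma elementary_upper v : E (upper v).
Proof.
pose P v := E (upper v).
rewrite -/(P v) -(sum_inj_proj D v); apply: (big_ind P) => [|u w Pu Pw|i _].
- have -> : P 0 = E 1%g; last exact: gen1.
  by congr E; apply: aut_eqP => -[x z]; rewrite /= /upper_fun /= scaler0 addr0.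
- have -> : P (u + w) = E (upper u * upper w)%g; last exact: genM.
  congr E; apply: aut_eqP => -[x z]; rewrite /= /upper_fun /=.
  by rewrite scalerDr addrAC addrA.
- apply: gen_sub; exists (Some i), None, (mklin (scale_linear (proj i v))).
  split=> // -[x z]; rewrite /= /upper_fun /=; congr pair => /=.
    by rewrite linearZ.
  by rewrite addr0.
Qed.

Lemma elementary_lower f : E (lower f).
Proof.
(* The sum of the functionals through the single summands is built along the list of indices,
   together with its linearity. *)
suff [h hf Eh] : exists2 h : {linear M -> R^o},
    forall x, h x = \sum_(i : dindex D) f (inj i (proj i x)) & E (lower h).
  have -> // : lower f = lower h.
  apply: aut_eqP => -[x z]; rewrite /= /lower_fun /= hf -linear_sum.
  by rewrite sum_inj_proj.
elim: (index_enum _) => [|i s [h hf Eh]].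
  exists (\0 : {linear M -> R^o}) => [x|]; first by rewrite big_nil.
  have -> : lower \0 = 1%g :> aut (M * R^o)%type; last exact: gen1.
  by apply: aut_eqP => -[x z]; rewrite /= /lower_fun /= addr0.
exists ((f \o @inj _ _ D i \o @proj _ _ D i) \+ h) => [x|].
  by rewrite big_cons -hf.
have -> : lower (f \o @inj _ _ D i \o @proj _ _ D i \+ h) =
    (lower (f \o @inj _ _ D i \o @proj _ _ D i) * lower h)%g.
  apply: aut_eqP => -[x z]; rewrite /= /lower_fun /=.
  by rewrite -addrA [h x + _]addrC.
apply: genM => //; apply: gen_sub.
exists None, (Some i), (f \o @inj _ _ D i); split=> // -[x z] /=.
by rewrite /lower_fun; congr pair; rewrite /= addr0.
Qed.

Lemma transvection_group_elementary : transvection_group M `<=` E.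
Proof.
apply: gen_min => [|f g Ef Eg|g [[v ->]|[f ->]]].
- exact: gen1.
- by apply: genM => //; apply: genV.
- exact: elementary_upper.
- exact: elementary_lower.
Qed.

Hypothesis rank1 : forall (i j : dindex D)
    (s : {linear summand j -> summand i}), i != j ->
  exists (v : summand i) (f : {linear summand j -> R^o}),
    forall x, s x = (f x : R) *: v.

Lemma elementary_transvection_group : E `<=` transvection_group M.
Proof.
apply: gen_min => [|f g Ef Eg|g].
- exact: gen1.
- by apply: genM => //; apply: genV.
move=> [[i|] [[j|] [s [//= ij hg]]]].
- have {ij}ij : i != j by apply: contraNneq ij => ->.
  have [v [f hf]] := rank1 s ij.
  pose h : {linear M -> R^o} := f \o @proj _ _ D j.
  (* The commutator of [upper u] and [lower h] is x |-> x + h(x) u as soon as h(u) = 0. Here u is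
     [inj i v], and i != j gives h(u) = 0. *)
  have -> : g = (upper (inj i v) * lower h *
      (upper (inj i v))^-1 * (lower h)^-1)%g.
    apply: aut_eqP => -[x z]; rewrite hg /= /upper_fun /lower_fun /=.
    rewrite !(linearB, linearD, linearN, linearZ) /=.
    rewrite !proj_inj_neq 1?eq_sym // !linear0.
    rewrite addr0 addrNK; congr pair => /=; rewrite ?addr0 //.
    rewrite hf linearZ -addrA; congr (_ + _).
    by rewrite scalerN scalerBl opprB addrNK.
  apply: genM; last by apply: genV; apply: transvection_group_lower.
  apply: genM; last by apply: genV; apply: transvection_group_upper.
  by apply: genM; [apply: transvection_group_upper|apply: transvection_group_lower].
- have -> : g = upper (inj i (s 1)); last exact: transvection_group_upper.
  apply: aut_eqP => -[x z]; rewrite hg /= /upper_fun /=.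
  congr pair => /=; last by rewrite addr0.
  by rewrite -!linearZ; congr (_ + inj i (s _)); rewrite [RHS]mulr1.
- have -> : g = lower (s \o @proj _ _ D j); last exact: transvection_group_lower.
  apply: aut_eqP => -[x z]; rewrite hg /= /lower_fun /=.
  by congr pair => /=; rewrite addr0.
Qed.

End General.

Variable P0 : lmodType R.

(* All summands but one are free of rank 1. *)
Lemma stab_rank1 k (i j : dindex (stab_decomp P0 k))
    (s : {linear summand j -> summand i}) :
  i != j -> exists (v : summand i) (f : {linear summand j -> R^o}),
    forall x, s x = (f x : R) *: v.
Proof.
elim: k i j s => [[] []//|k IHk] [i|] [j|] // s ij.
- have {ij}ij : i != j by apply: contraNneq ij => ->.
  exact: (IHk i j s ij).
- exists (s 1), (mklin (scale_linear (1 : R^o))) => x /=.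
  by rewrite -linearZ; congr (s _); rewrite [RHS]mulr1 [RHS]mulr1.
- by exists 1, s => x; rewrite [RHS]mulr1.
Qed.

(** In terms of the modules P_n: E(P_(k+3)) = EG(P_(k+2)). *)
Lemma EstabS k : Estab P0 k.+1 = transvection_group (stab P0 k).
Proof.
apply/seteqP; split; last exact: transvection_group_elementary.
apply: elementary_transvection_group => i j s.
exact: stab_rank1.
Qed.

End ElementaryGroup.

(** * Injective stability *)

(** If the row (f, c) on Q (+) R is unimodular, so is f + c h for some functional h on Q; unimodular
    means that the value 1 is taken. *)
Definition stable_range_condition (R : comPzRingType) (Q : lmodType R) :=
  forall (f : {linear Q -> R^o}) (c : R),
  (exists v t, (f v : R) + c * t = 1) ->
  exists (h : {linear Q -> R^o}) w, (f w : R) + c * (h w : R) = 1.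

Section InjectiveStability.
Variables (R : comPzRingType) (Q : lmodType R).
Hypothesis srQ : stable_range_condition Q.
Local Notation QR := (Q * R^o)%type.
Local Notation QRR := (QR * R^o)%type.
Local Notation E := (transvection_group Q).

Definition swap_fun (p : QRR) : QRR := ((p.1.1, p.2), p.1.2).
Lemma swap_linear : linear swap_fun. Proof. by []. Qed.
Lemma swapK : cancel swap_fun swap_fun. Proof. by move=> [[x y] z]. Qed.
Definition swap : aut QRR := Aut swap_linear swapK swapK.

(** [swap_sum g] acts through g on (x, z) and fixes y; [swap_lower f] adds f(x, z) to y; [corner a]
    adds a y to z. *)
Definition swap_sum (g : aut QR) := (swap * aut_sum R^o g * swap)%g.
Definition swap_lower (f : {linear QR -> R^o}) := (swap * lower f * swap)%g.
Definition corner (a : R) : aut QRR := lower (a \*: (snd : {linear QR -> R^o})).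

Lemma cornerE a x y z : corner a ((x, y), z) = ((x, y), z + a * y).
Proof. by []. Qed.

Lemma aut_sumM (M N : lmodType R) (f g : aut M) :
  aut_sum N (f * g)%g = (aut_sum N f * aut_sum N g)%g.
Proof. by apply: aut_eqP => -[]. Qed.

Lemma swap_sumM f g : swap_sum (f * g)%g = (swap_sum f * swap_sum g)%g.
Proof.
apply: aut_eqP => -[[x y] z].
by rewrite /= /swap_fun /= -surjective_pairing.
Qed.

Lemma upperD (M : lmodType R) (v w : M) :
  upper (v + w) = (upper v * upper w)%g.
Proof.
apply: aut_eqP => -[x z]; rewrite /= /upper_fun /=.
by rewrite scalerDr -addrA [_ *: w + _]addrC.
Qed.

Lemma aut_upper (M : lmodType R) (g : aut M) v :
  (aut_sum R^o g * upper v = upper (g v) * aut_sum R^o g)%g.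
Proof.
apply: aut_eqP => -[x z]; rewrite /= /upper_fun /=; congr pair.
by rewrite addrC aut_linear addrC.
Qed.

Lemma lower_aut (M : lmodType R) (g : aut M) (f h : {linear M -> R^o}) :
  (forall x, f (g x) = h x) ->
  (lower f * aut_sum R^o g = aut_sum R^o g * lower h)%g.
Proof.
by move=> fg; apply: aut_eqP => -[x z]; rewrite /= /lower_fun /= fg.
Qed.

(** The factor p is [swap_sum b * swap_lower f], the middle one is [corner a], and q is
    [upper v * aut_sum R^o c]. *)
Definition decomposable : set (aut QRR) := [set g |
  exists b f a v c, [/\ E b, E c & g =
    (swap_sum b * swap_lower f * corner a * upper v * aut_sum R^o c)%g]].

Lemma decomposable_corner a : decomposable (corner a).
Proof.
exists 1%g, \0, a, 0, 1%g; split; try exact: gen1.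
apply: aut_eqP => -[[x y] z].
by rewrite /= /upper_fun /lower_fun /= /swap_fun /= !(scaler0, addr0).
Qed.

Lemma decomposable_aut g c :
  decomposable g -> E c -> decomposable (g * aut_sum R^o c)%g.
Proof.
case=> b [f [a [v [c' [Eb Ec' ->]]]]] Ec.
exists b, f, a, v, (c' * c)%g; split=> //; first exact: genM.
by rewrite aut_sumM !mulgA.
Qed.

Lemma decomposable_upper g w :
  decomposable g -> decomposable (g * upper w)%g.
Proof.
case=> b [f [a [v [c [Eb Ec ->]]]]].
exists b, f, a, (v + c w), c; split=> //.
by rewrite upperD -!mulgA aut_upper.
Qed.

Lemma decomposable_swap_sum b g :
  E b -> decomposable g -> decomposable (swap_sum b * g)%g.
Proof.
move=> Eb [b' [f [a [v [c [Eb' Ec ->]]]]]].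
exists (b * b')%g, f, a, v, c; split=> //; first exact: genM.
by rewrite swap_sumM !mulgA.
Qed.

Lemma decomposable_swap_lower f g :
  decomposable g -> decomposable (swap_lower f * g)%g.
Proof.
case=> b [f' [a [v [c [Eb Ec ->]]]]].
have lfb : linear (fun p => f (b p)) by move=> r x y; rewrite aut_linear linearP.
exists b, (mklin lfb \+ f'), a, v, c; split=> //.
have e : (swap_lower f * (swap_sum b * swap_lower f') =
    swap_sum b * swap_lower (mklin lfb \+ f'))%g.
  apply: aut_eqP => -[[x y] z]; rewrite /= /lower_fun /= /swap_fun /=.
  by rewrite -addrA [f' _ + _]addrC -surjective_pairing.
by rewrite 3!mulgA e.
Qed.

(** The two left factors add y (w, a) to (x, z). Moving them past b, which acts on (x, z), replaces
    the column (w, a) by b^-1 (w, a). *)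
Lemma column_swap_sum b w a :
  (corner a * aut_sum R^o (upper w) * swap_sum b =
   swap_sum b * corner (aut_inv b (w, a)).2 *
     aut_sum R^o (upper (aut_inv b (w, a)).1))%g.
Proof.
apply: aut_eqP => -[[x y] z]; rewrite /= /lower_fun /upper_fun /= /swap_fun /=.
have -> : (x + y *: (aut_inv b (w, a)).1, z + (aut_inv b (w, a)).2 *: y) =
    y *: aut_inv b (w, a) + (x, z).
  by congr pair => /=; rewrite addrC //; congr (_ + _); apply: mulrC.
rewrite aut_linear aut_invK /=.
congr (_, _, _) => /=; rewrite addrC //; congr (_ + _); exact: mulrC.
Qed.

Lemma decomposable_special a v w (f : {linear Q -> R^o}) : decomposable
  (corner a * upper v * aut_sum R^o (upper w) *
   lower (f \o (fst : {linear QR -> Q})))%g.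
Proof.
(* With t = z + f x, the product adds y w + t v.1 to x. In the new factorization [upper w] meets y +
   t v.2 instead of y, hence the correction. *)
set w2 := v.1 - (v.2 : R) *: w.
set b := (upper w2 * lower f)%g.
set p := aut_inv b (w, a).
have Eb : E b.
  apply: genM; [exact: transvection_group_upper|exact: transvection_group_lower].
suff -> : (corner a * upper v * aut_sum R^o (upper w) *
    lower (f \o (fst : {linear QR -> Q})))%g =
  (swap_sum b * corner p.2 * aut_sum R^o (upper p.1) * upper (0, v.2 : R^o) *
    aut_sum R^o (lower ((v.2 : R) \*: f)))%g.
  apply: decomposable_aut; last exact: transvection_group_lower.
  apply: decomposable_upper; apply: decomposable_aut; last first.
    exact: transvection_group_upper.
  by apply: decomposable_swap_sum => //; apply: decomposable_corner.
rewrite -column_swap_sum.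
apply: aut_eqP => -[[x y] z].
rewrite /= /lower_fun /upper_fun /= /swap_fun /= /w2 !(scaler0, addr0).
have -> : y + v.2 *: f x + z *: v.2 = y + (z + f x) *: v.2.
  have e (t q r s : R) : t + q * r + s * q = t + (s + r) * q by ring.
  exact: e.
congr (_, _, _) => /=; move: (z + f x) => t; rewrite scalerBr scalerDl scalerA.
have e (A B C D : Q) : A + C + B = A + (B - D) + (C + D).
  by rewrite [C + D]addrC addrA -[A + _ + D]addrA subrK addrAC.
exact: e.
Qed.

Lemma decomposable_core a v b c : E b -> decomposable
  (corner a * upper v * aut_sum R^o b * corner c)%g.
Proof.
move=> Eb.
(* [b^-1] has bottom row [(f, r)]. The stable range condition provides [s] in
   [E] such that [b^-1 s] has bottom row [(g, 0)]; then [b * corner c] is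
   [s * lower (c g)] up to a right factor in [E]. *)
have linr : linear (fun x => (aut_inv b (x, 0)).2).
  move=> r x y; rewrite -[RHS]/((r *: aut_inv b (x, 0) + aut_inv b (y, 0)).2).
  by rewrite -inv_linear; congr (aut_inv b _).2; apply: inl_linear.
set f := mklin linr; set r := (aut_inv b (0, 1)).2.
have invE x y : (aut_inv b (x, y)).2 = (f x : R) + r * y.
  rewrite [LHS](prod_linearE (snd \o mklin (inv_linear b))) /=.
  by rewrite [y * _]mulrC.
have [|h [w hw]] := srQ (f := f) (c := r).
  by exists (b (0, 1)).1, (b (0, 1)).2; rewrite -invE -surjective_pairing aut_funK.
set g := (f \+ r \*: h : {linear Q -> R^o}).
(* The row (f, r) times [lower h] is (g, r). As g w = 1, the second factor then replaces r by r - r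
   g(w) = 0. *)
set s := (lower h * upper (- r *: w))%g.
have Es : E s.
  apply: genM; [exact: transvection_group_lower|exact: transvection_group_upper].
have bs x : (aut_inv b (s x)).2 = g x.1.
  case: x => x y; rewrite /= /lower_fun /upper_fun /= invE !linearD !linearZ /=.
  have e (F H Fw Hw t : R) : Fw + r * Hw = 1 ->
      F + t * (- r * Fw) + r * (t + (H + t * (- r * Hw))) = F + r * H.
    move=> e; transitivity (F + r * H + r * t * (1 - (Fw + r * Hw))); first ring.
    by rewrite e subrr mulr0 addr0.
  exact: e.
have -> : (corner a * upper v * aut_sum R^o b * corner c =
  corner a * upper v * aut_sum R^o s *
   lower ((c \*: g) \o (fst : {linear QR -> Q})) * aut_sum R^o (s^-1 * b))%g.
  rewrite -!mulgA; congr (_ * (_ * _))%g.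
  have bsK : (b * (b^-1 * s) = s)%g by rewrite mulgA mulgV mul1g.
  rewrite -[in X in (_ = X * _)%g]bsK aut_sumM -mulgA; congr (_ * _)%g.
  rewrite mulgA -(@lower_aut _ _ (c \*: snd)) => [|x]; last first.
    exact: (congr1 ( *%R c) (bs x)).
  rewrite -mulgA -aut_sumM mulgA -(mulgA _ s) mulgV mulg1 mulVg.
  by apply: aut_eqP => -[].
apply: decomposable_aut; last by apply: genM => //; apply: genV.
pose hf : {linear QR -> R^o} := h \o (fst : {linear QR -> Q}).
(* [lower h] adds h x to y, whence [corner a] adds a h x to z. Both effects move to the left, into
   the factor p. *)
have -> : (corner a * upper v * aut_sum R^o s =
  swap_lower hf * swap_sum (lower (a \*: h)) *
   (corner a * upper (aut_inv (lower h) v) * aut_sum R^o (upper (- r *: w))))%g.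
  rewrite aut_sumM !mulgA; congr (_ * _)%g; rewrite -(mulgA (corner a)).
  have -> : (upper v * aut_sum R^o (lower h) =
      aut_sum R^o (lower h) * upper (aut_inv (lower h) v))%g.
    by rewrite aut_upper aut_invK.
  rewrite !mulgA; congr (_ * _)%g; apply: aut_eqP => -[[x y] z].
  rewrite /= /lower_fun /= /swap_fun /= -addrA; congr (_, _).
  by rewrite [_ *: (_ + _)]mulrDr [_ + a * h x]addrC.
rewrite -2!mulgA; apply: decomposable_swap_lower.
apply: decomposable_swap_sum; first exact: transvection_group_lower.
exact: decomposable_special.
Qed.

Lemma decomposable_mul_corner g c :
  decomposable g -> decomposable (g * corner c)%g.
Proof.
case=> b [f [a [v [b' [Eb Eb' ->]]]]].
rewrite -4!mulgA; apply: decomposable_swap_sum => //.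
by apply: decomposable_swap_lower; rewrite !mulgA; apply: decomposable_core.
Qed.

Lemma decomposable_lower g f : decomposable g -> decomposable (g * lower f)%g.
Proof.
have linr : linear (fun x => f (x, 0)).
  by move=> r x y; rewrite -linearP; congr (f _); apply: inl_linear.
set h := lower (mklin linr); set c := f (0, 1).
(* [corner c] and the conjugate of [corner 1] by [h] generate [lower f]. *)
have -> : lower f = (aut_sum R^o h^-1 * corner 1 * aut_sum R^o h *
    corner (c - 1))%g.
  apply: aut_eqP => -[[x y] z]; rewrite /= /lower_fun /= prod_linearE addrK.
  congr (_, _); rewrite -addrA; congr (_ + _).
  have e (F t d : R) : F + t * d = (d - 1) * t + 1 * (t + F) by ring.
  exact: e.
move=> Dg; rewrite !mulgA; apply: decomposable_mul_corner.
apply: decomposable_aut; last exact: transvection_group_lower.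
apply: decomposable_mul_corner; apply: decomposable_aut => //.
by apply: genV; apply: transvection_group_lower.
Qed.

Lemma transvection_group_decomposable :
  transvection_group QR `<=` decomposable.
Proof.
apply: gen_min_right => [|g _ Dg [[v ->]|[f ->]]|g].
- have -> : 1%g = corner 0; last exact: decomposable_corner.
  by apply: aut_eqP => -[[x y] z]; rewrite cornerE mul0r addr0.
- exact: decomposable_upper.
- exact: decomposable_lower.
- exact: transvectionV.
Qed.

Lemma injective_stability f :
  transvection_group QR (aut_sum R^o f) -> E f.
Proof.
move=> /transvection_group_decomposable[b [h [a [v [c [Eb Ec ef]]]]]].
have {}ef : (aut_sum R^o (f * c^-1) * upper (- v) =
    swap_sum b * swap_lower h * corner a)%g.
  have cK : (aut_sum R^o c * aut_sum R^o c^-1 = 1)%g.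
    by rewrite -aut_sumM mulgV; apply: aut_eqP => -[].
  by rewrite aut_sumM ef -(mulgA _ (aut_sum R^o c)) cK mulg1 -(upperV v) mulgK.
have e x y z := congr1 (fun g : aut QRR => g ((x, y), z)) ef.
(* The left-hand side of [ef] fixes the coordinate z; on the right-hand side this coordinate comes
   from b (x, z + a y). *)
have eb x y z : (b (x, z + a * y)).2 = z by have /= := congr1 snd (e x y z).
have bE x z : b (x, z) = b (x, 0) + (z : R) *: b (0, 1).
  rewrite addrC -aut_linear; congr (b _); congr pair; rewrite /=.
    by rewrite scaler0 add0r.
  by rewrite addr0 [RHS]mulr1.
have a0 : a = 0.
  have b01 : (b (0, 1)).2 = 1 by have := eb 0 0 1; rewrite mulr0 addr0.
  have b00 : (b (0, 0)).2 = 0 by have := eb 0 0 0; rewrite mulr0 addr0.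
  have := eb 0 1 0; rewrite mulr1 add0r bE /= b01 b00 add0r.
  by move=> <-; rewrite [RHS]mulr1.
have {}eb x z : (b (x, z)).2 = z by have := eb x 0 z; rewrite mulr0 addr0.
have linr : linear (fun x => h (x, 0)).
  by move=> r x y; rewrite -linearP; congr (h _); apply: inl_linear.
pose w := (b (0, 1)).1.
(* At z = 0, [ef] says that f c^-1 sends (x, y) to ((b (x, 0)).1, y + h (x, 0)). As b (x, t) = ((b
   (x, 0)).1 + t w, t), the factor [upper (- w)] removes t w. *)
have -> : f = (upper (- w) * b * lower (mklin linr) * c)%g.
  apply: (mulIg (c^-1)%g); rewrite mulgK; apply: aut_eqP => -[x y].
  have := congr1 fst (e x y 0).
  rewrite /= /upper_fun /lower_fun /= /swap_fun /=.
  rewrite a0 !(scale0r, addr0) => ->.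
  by rewrite eb (bE x (y + _)) /= scalerN addrK.
apply: genM => //; apply: genM; last exact: transvection_group_lower.
by apply: genM => //; apply: transvection_group_upper.
Qed.

End InjectiveStability.

(** * Minimal primes and prime avoidance *)

Section NoetherianPrimes.
Variable R : comPzRingType.
Implicit Types (I J p q : set R) (l : seq (set R)).

Lemma ideal_addKr I x y : is_ideal I -> I (x + y) -> I y -> I x.
Proof.
case=> _ ID IM Ixy Iy; rewrite -(addrK y x) -mulN1r.
by apply: ID => //; apply: IM.
Qed.

Lemma ideal_mulr I a x : is_ideal I -> I x -> I (x * a).
Proof. by case=> _ _ IM Ix; rewrite mulrC; apply: IM. Qed.

Lemma ideal_sum I n (F : 'I_n -> R) :
  is_ideal I -> (forall i, I (F i)) -> I (\sum_i F i).
Proof. by case=> I0 ID _ IF; apply: (big_ind I). Qed.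

Definition ideal_add I a : set R := [set x | exists i r, I i /\ x = i + r * a].

Lemma ideal_add_ideal I a : is_ideal I -> is_ideal (ideal_add I a).
Proof.
move=> [I0 ID IM]; split.
- by exists 0, 0; rewrite mul0r addr0.
- move=> _ _ [i [r [Ii ->]]] [j [s [Ij ->]]]; exists (i + j), (r + s).
  by split; [apply: ID | ring].
- move=> b _ [i [r [Ii ->]]]; exists (b * i), (b * r).
  by split; [apply: IM | ring].
Qed.

Lemma ideal_add_proper I a : is_ideal I -> ~ I a -> I `<` ideal_add I a.
Proof.
move=> [I0 ID IM] Ia; split=> [x Ix|sub]; first by exists x, 0; rewrite mul0r addr0.
by apply: Ia; apply: sub; exists 0, 1; rewrite mul1r add0r.
Qed.

Lemma ideal_add_mul I a b x y : is_ideal I -> I (a * b) ->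
  ideal_add I a x -> ideal_add I b y -> I (x * y).
Proof.
move=> [I0 ID IM] Iab [i [r [Ii ->]]] [j [s [Ij ->]]].
have -> : (i + r * a) * (j + s * b) =
  (j + s * b) * i + (r * a * j + r * s * (a * b)) by ring.
by apply: (ID); [apply: IM|apply: ID; apply: IM].
Qed.

Lemma prime_or_split I : is_ideal I -> ~ I 1 ->
  is_prime I \/ exists a b, [/\ I (a * b), ~ I a & ~ I b].
Proof.
move=> II I1; case: (pselect (exists a b, [/\ I (a * b), ~ I a & ~ I b])).
  by right.
move=> nex; left; split=> // a b Iab.
case: (pselect (I a)) => [|Ia]; first by left.
case: (pselect (I b)) => [|Ib]; first by right.
by case: nex; exists a, b.
Qed.

Hypothesis noethR : noetherian R.

(** A failure of P passes to strictly larger ideals, hence along an infinite increasing sequence.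
    Its union is finitely generated, and one term contains all the generators. *)
Lemma noetherian_ind (P : set R -> Prop) :
  (forall I, is_ideal I -> (forall J, is_ideal J -> I `<` J -> P J) -> P I) ->
  forall I, is_ideal I -> P I.
Proof.
move=> ind I0 II0; apply: contrapT => nP0.
pose T := {I | is_ideal I /\ ~ P I}.
have step (t : T) : exists u : T, sval t `<` sval u.
  case: t => I [II nPI] /=; apply: contrapT => nex; apply: nPI; apply: ind => //.
  move=> J IJ sub; apply: contrapT => nPJ; apply: nex.
  by exists (exist _ J (conj IJ nPJ)).
have [F hF] := choice step.
pose c n := sval (iter n F (exist _ I0 (conj II0 nP0))).
have cI n : is_ideal (c n) by rewrite /c; case: (iter _ _ _) => J [].
have cS n : c n `<` c n.+1 by apply: hF.
have cle m n : (m <= n)%N -> c m `<=` c n.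
  elim: n => [|n IHn]; first by rewrite leqn0 => /eqP ->.
  rewrite leq_eqVlt => /predU1P[->//|/IHn sub].
  by apply: subset_trans sub _; have [] := cS n.
have [|n [g eg]] := noethR (I := \bigcup_n c n).
  split.
  - by exists 0%N => //; have [] := cI 0%N.
  - move=> x y [m _ cx] [n _ cy]; exists (maxn m n) => //.
    have [_ cD _] := cI (maxn m n); apply: cD.
      by apply: cle cx; apply: leq_maxl.
    by apply: cle cy; apply: leq_maxr.
  - by move=> a x [n _ cx]; exists n => //; have [_ _] := cI n; apply.
have cg (i : 'I_n) : exists k, c k (g i).
  have : (\bigcup_n c n) (g i).
    rewrite eg; exists (fun j => (j == i)%:R).
    rewrite (bigD1 i) //= eqxx mul1r big1 ?addr0 // => j /negPf ->.
    by rewrite mul0r.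
  by case=> k _ ck; exists k.
have [k hk] := choice cg.
pose K := (\max_i k i)%N.
have [_] := cS K; apply=> x cx.
have : (\bigcup_n c n) x by exists K.+1.
rewrite eg => -[a ->]; apply: ideal_sum => // i.
have [_ _] := cI K; apply; apply: cle (hk i).
exact: leq_bigmax.
Qed.

(** If a b lies in I, then I + (a) and I + (b) cannot both contain 1, since their product lies in I;
    the induction goes on with a proper one. *)
Lemma proper_sub_prime I : is_ideal I -> ~ I 1 ->
  exists2 p, is_prime p & I `<=` p.
Proof.
move: I; apply: noetherian_ind => I II IH I1.
have [pI|[a [b [Iab Ia Ib]]]] := prime_or_split II I1; first by exists I.
have rec c : ~ I c -> ~ ideal_add I c 1 -> exists2 p, is_prime p & I `<=` p.
  move=> Ic Ic1; have [//||//|p pp sub] := IH (ideal_add I c).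
  - exact: ideal_add_ideal.
  - exact: ideal_add_proper.
  by exists p => //; apply: subset_trans sub; have [] := ideal_add_proper II Ic.
case: (pselect (ideal_add I a 1)) => [a1|]; last exact: rec.
case: (pselect (ideal_add I b 1)) => [b1|]; last exact: rec.
by case: I1; rewrite -[1]mulr1; apply: ideal_add_mul a1 b1.
Qed.

(** A finite list of primes over I to which all the minimal ones belong. If it is also an
    [antichain], it has no others. *)
Definition covers I l := (forall p, p \in l -> is_prime p /\ I `<=` p) /\
  forall p, is_prime p -> I `<=` p -> exists2 q, q \in l & q `<=` p.

Definition antichain l :=
  forall p q, p \in l -> q \in l -> p `<=` q -> p = q.

(** A prime containing a b contains a or b, so covers of I + (a) and I + (b) together cover I. *)
Lemma finite_cover I : is_ideal I -> exists l, covers I l.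
Proof.
move: I; apply: noetherian_ind => I II IH.
case: (pselect (I 1)) => [I1|I1].
  by exists [::]; split=> [p|p [_ p1 _] sub]; [rewrite in_nil|case: p1; apply: sub].
have [pI|[a [b [Iab Ia Ib]]]] := prime_or_split II I1.
  exists [:: I]; split=> [p|p _ sub]; last by exists I; rewrite ?mem_head.
  by rewrite inE => /eqP ->; split=> // x.
have [la [la1 la2]] := IH _ (ideal_add_ideal a II) (ideal_add_proper II Ia).
have [lb [lb1 lb2]] := IH _ (ideal_add_ideal b II) (ideal_add_proper II Ib).
exists (la ++ lb); split=> [p|p pp sub].
  by rewrite mem_cat => /orP[/la1|/lb1] [pp sub]; split=> //;
    apply: subset_trans sub; have [] := ideal_add_proper II Ia;
    have [] := ideal_add_proper II Ib.
have [pI _ pM] := pp; have [_ pD pZ] := pI.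
have add c : p c -> ideal_add I c `<=` p.
  by move=> pc _ [i [r [Ii ->]]]; apply: pD; [apply: sub|apply: pZ].
have [pa|pb] := pM _ _ (sub _ Iab).
  by have [q ql qp] := la2 p pp (add _ pa); exists q; rewrite // mem_cat ql.
by have [q ql qp] := lb2 p pp (add _ pb); exists q; rewrite // mem_cat ql orbT.
Qed.

(** Dropping a prime that strictly contains another one of the list leaves a shorter cover. *)
Lemma minimal_primes I : is_ideal I -> exists2 l, covers I l & antichain l.
Proof.
move=> /finite_cover[l]; have [n] := ubnP (size l).
elim: n l => // n IHn l szl [l1 l2].
case: (pselect (antichain l)) => [|nac]; first by exists l.
have [p [q [pl ql pq npq]]] :
    exists p q, [/\ p \in l, q \in l, p `<=` q & p <> q].
  apply: contrapT => nex; apply: nac => p q pl ql pq.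
  by apply: contrapT => npq; apply: nex; exists p, q.
apply: (IHn [seq x <- l | x != q]).
  rewrite size_filter -ltnS (leq_trans _ szl) // ltnS -(count_predC (pred1 q) l).
  by rewrite -[X in (X < _)%N]add0n ltn_add2r -has_count has_pred1.
split=> [x|x px sub]; first by rewrite mem_filter => /andP[_ /l1].
have [y yl yx] := l2 x px sub.
case: (eqVneq y q) => [yq|yq]; last by exists y; rewrite // mem_filter yq.
exists p; first by rewrite mem_filter pl andbT; apply/eqP.
by apply: subset_trans pq _; rewrite -yq.
Qed.

(** These correspond to the minimal primes of I in the localization R_a: a prime inside one that
    avoids a avoids a as well. *)
Lemma minimal_primes_away I a : is_ideal I -> exists l, [/\
  forall p, p \in l -> [/\ is_prime p, I `<=` p & ~ p a], antichain l &
  forall p, is_prime p -> I `<=` p -> ~ p a -> exists2 q, q \in l & q `<=` p].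
Proof.
move=> /minimal_primes[l [l1 l2] ac]; exists [seq p <- l | ~~ `[< p a >]].
split=> [p|p q|p pp sub pa].
- by rewrite mem_filter => /andP[/asboolP pa /l1[]].
- by rewrite !mem_filter => /andP[_ pl] /andP[_ ql]; apply: ac.
- have [q ql qp] := l2 p pp sub; exists q => //.
  by rewrite mem_filter ql andbT; apply/asboolP => /qp.
Qed.

End NoetherianPrimes.

Section Avoidance.
Variable R : comPzRingType.
Implicit Types (I J p q : set R) (l : seq (set R)).

Lemma antichain_behead p l : antichain (p :: l) -> antichain l.
Proof. by move=> ac q r ql rl; apply: ac; rewrite inE ?ql ?rl orbT. Qed.

(** The product of elements chosen in each q outside p; it avoids p because p is prime. *)
Lemma separate p l : is_prime p -> (forall q, q \in l -> is_prime q) ->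
  p \notin l -> antichain (p :: l) ->
  exists u, ~ p u /\ forall q, q \in l -> q u.
Proof.
move=> [_ p1 pM]; elim: l => [|q l IHl] lP; first by exists 1.
rewrite inE negb_or => /andP[/eqP pq pl] ac.
have [| // ||u [pu lu]] := IHl.
- by move=> r rl; apply: lP; rewrite inE rl orbT.
- move=> r s; rewrite !inE => rl sl; apply: ac; rewrite !inE.
    by case/orP: rl => ->; rewrite ?orbT.
  by case/orP: sl => ->; rewrite ?orbT.
have [v [qv pv]] : exists v, q v /\ ~ p v.
  apply: contrapT => nex; apply: pq; apply/esym.
  apply: ac; rewrite ?inE ?eqxx ?orbT // => v qv.
  by apply: contrapT => pv; apply: nex; exists v.
exists (u * v); split=> [/pM[]//|r]; rewrite inE => /predU1P[->|/[dup] rl /lu ru].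
  by have [[_ _ qM] _ _] := lP q (mem_head _ _); apply: qM.
by apply: ideal_mulr => //; have [|] := lP r; rewrite // inE rl orbT.
Qed.

(** Prime avoidance for the coset c + I. If the c + d found for the tail lies in p, add u h, with u
    outside p but in the other primes, and h in I outside p. *)
Lemma avoidance I l c : is_ideal I -> (forall p, p \in l -> is_prime p) ->
  antichain l -> (forall p, p \in l -> exists2 h, I h & ~ p h) ->
  exists2 d, I d & forall p, p \in l -> ~ p (c + d).
Proof.
move=> II; have [I0 ID IM] := II; elim: l => [|p l IHl] lP ac hI.
  by exists 0.
have lP' q : q \in l -> is_prime q by move=> ql; apply: lP; rewrite inE ql orbT.
have [|d Id ld] := IHl lP' (antichain_behead ac).
  by move=> q ql; apply: hI; rewrite inE ql orbT.
have pp := lP p (mem_head _ _); have [pI _ pM] := pp.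
case: (boolP (p \in l)) => pl.
  by exists d => // q; rewrite inE => /predU1P[->|]; apply: ld.
case: (pselect (p (c + d))) => [pd|pd]; last first.
  by exists d => // q; rewrite inE => /predU1P[->|/ld].
have [u [pu lu]] := separate pp lP' pl ac.
have [h Ih ph] := hI p (mem_head _ _).
exists (d + u * h); first by apply: ID => //; apply: IM.
move=> q; rewrite inE addrA => /predU1P[->|ql].
  by rewrite addrC => /(ideal_addKr pI)/(_ pd)/pM[].
have [qI _ _] := lP' q ql.
move=> /(ideal_addKr qI) h1; apply: (ld q ql); apply: h1.
by apply: ideal_mulr => //; apply: lu.
Qed.

Lemma avoidance_mul l c b : (forall p, p \in l -> is_prime p /\ ~ p b) ->
  antichain l -> exists t, forall p, p \in l -> ~ p (c + b * t).
Proof.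
move=> lP ac.
have [| | // | |d [t _ <-] hd] := @avoidance (range ( *%R b)) l c.
- split.
  + by exists 0; rewrite // mulr0.
  + by move=> _ _ [x _ <-] [y _ <-]; exists (x + y); rewrite // mulrDr.
  + by move=> a _ [x _ <-]; exists (a * x) => //; ring.
- by move=> p /lP[].
- by move=> p /lP[_ pb]; exists b => //; exists 1; rewrite // mulr1.
by exists t => p /hd.
Qed.

End Avoidance.

(** * Stable range *)

Section Frames.
Variables (R : comPzRingType) (P : lmodType R).
Implicit Types (p : set R) (l : seq (set R)) (g : {linear P -> R^o}) (v : P).

Definition minor g1 g2 v1 v2 : R := (g1 v1 : R) * g2 v2 - (g1 v2 : R) * g2 v1.

Definition rank_ge2_on l := exists g1 g2 v1 v2,
  forall p, p \in l -> ~ p (minor g1 g2 v1 v2).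

(** Modulo d, all functionals and vectors are e times the given ones, so the minor is multiplied by
    e^4. *)
Lemma minor_glue g1 g2 v1 v2 (h1 h2 : {linear P -> R^o}) (w1 w2 : P)
    (e d : R) : exists k,
  minor (e \*: g1 \+ d \*: h1) (e \*: g2 \+ d \*: h2)
    (e *: v1 + d *: w1) (e *: v2 + d *: w2) =
  e ^+ 4 * minor g1 g2 v1 v2 + d * k.
Proof.
pose k (f h : {linear P -> R^o}) v w : R := e * f w + e * h v + d * h w.
have kE (f h : {linear P -> R^o}) v w :
    ((e \*: f \+ d \*: h : {linear P -> R^o}) (e *: v + d *: w) : R) =
    e ^+ 2 * f v + d * k f h v w.
  rewrite /= !linearD !linearZ /= /k.
  have r (a b a' b' : R) :
    e * (e * a) + d * (e * b) + (e * (d * a') + d * (d * b')) =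
    e ^+ 2 * a + d * (e * b + e * a' + d * b') by ring.
  exact: r.
rewrite /minor !kE; move: (k g1 h1 v1 w1) (k g2 h2 v2 w2) (k g1 h1 v2 w2)
  (k g2 h2 v1 w1) => k11 k22 k12 k21.
exists (e ^+ 2 * ((g1 v1 : R) * k22 + k11 * (g2 v2 : R) - (g1 v2 : R) * k21
  - k12 * (g2 v1 : R)) + d * (k11 * k22 - k12 * k21)).
by ring.
Qed.

(** Two frames are combined with weights e, outside p and in the other primes, and d, in p and
    outside the others: each prime sees only its own frame. *)
Lemma rank_ge2_glue l : (forall p, p \in l -> is_prime p) -> antichain l ->
  (forall p, p \in l -> rank_ge2_on [:: p]) -> rank_ge2_on l.
Proof.
elim: l => [|p l IHl] lP ac rk.
  by exists \0, \0, 0, 0 => p; rewrite in_nil.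
have lP' q : q \in l -> is_prime q by move=> ql; apply: lP; rewrite inE ql orbT.
have [|h1 [h2 [w1 [w2 hl]]]] := IHl lP' (antichain_behead ac).
  by move=> q ql; apply: rk; rewrite inE ql orbT.
have pp := lP p (mem_head _ _).
case: (boolP (p \in l)) => pl.
  by exists h1, h2, w1, w2 => q; rewrite inE => /predU1P[->|]; apply: hl.
have [g1 [g2 [v1 [v2 hp]]]] := rk p (mem_head _ _).
have {}hp := hp p (mem_head _ _).
have [e [pe le]] := separate pp lP' pl ac.
have [|q ql|d pd ld] := @avoidance _ p l 0 _ lP' (antichain_behead ac).
- by case: pp.
- apply: contrapT => nex; have [] := negP pl; rewrite (_ : p = q) //.
  apply: ac; rewrite ?mem_head // ?inE ?ql ?orbT // => x px.
  by apply: contrapT => qx; apply: nex; exists x.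
exists (e \*: g1 \+ d \*: h1), (e \*: g2 \+ d \*: h2).
exists (e *: v1 + d *: w1), (e *: v2 + d *: w2) => q.
rewrite inE => /predU1P[->|ql].
  have [k ->] := minor_glue g1 g2 v1 v2 h1 h2 w1 w2 e d.
  have [pI _ pM] := pp.
  move=> /(ideal_addKr pI)/(_ (ideal_mulr _ pI pd))/pM[|//].
  by rewrite 3!exprS expr1 => /pM[|/pM[|/pM[]]].
have qp := lP' q ql; have [qI _ qM] := qp.
have qd : ~ q d by have := ld q ql; rewrite add0r.
have [k ek] := minor_glue h1 h2 w1 w2 g1 g2 v1 v2 d e.
have -> : minor (e \*: g1 \+ d \*: h1) (e \*: g2 \+ d \*: h2)
    (e *: v1 + d *: w1) (e *: v2 + d *: w2) =
    d ^+ 4 * minor h1 h2 w1 w2 + e * k.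
  rewrite -ek [e *: v1 + _]addrC [e *: v2 + _]addrC /minor /=.
  by congr (_ * _ - _ * _); apply: addrC.
move=> /(ideal_addKr qI)/(_ (ideal_mulr _ qI (le q ql)))/qM[|]; last exact: hl.
by rewrite 3!exprS expr1 => /qM[|/qM[|/qM[]]].
Qed.

(** Multiplying the functionals by the adjugate of the matrix of the g_i v_j turns that matrix into
    s times the identity. *)
Lemma rank_ge2_dual l : rank_ge2_on l -> exists g1 g2 v1 v2 (s : R),
  [/\ g1 v1 = s, g1 v2 = 0, g2 v1 = 0, g2 v2 = s &
      forall p, p \in l -> ~ p s].
Proof.
move=> [g1 [g2 [v1 [v2 hl]]]].
exists ((g2 v2 : R) \*: g1 \+ (- (g1 v2 : R)) \*: g2).
exists ((g1 v1 : R) \*: g2 \+ (- (g2 v1 : R)) \*: g1).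
exists v1, v2, (minor g1 g2 v1 v2); split=> //=; rewrite /minor.
- have r (a b c d : R) : d * a + - b * c = a * d - b * c by ring.
  exact: r.
- have r (a b : R) : a * b + - b * a = 0 by ring.
  exact: r.
- have r (a b : R) : a * b + - b * a = 0 by ring.
  exact: r.
- have r (a b c d : R) : a * d + - c * b = a * d - b * c by ring.
  exact: r.
Qed.

End Frames.

Section StableRange.
Variable R : comPzRingType.

Lemma proper_witness (p q : set R) x : p `<=` q -> q x -> ~ p x -> p `<` q.
Proof. by move=> pq qx px; split=> // /(_ x qx). Qed.

Lemma range_ideal (M : lmodType R) (f : {linear M -> R^o}) :
  is_ideal (range f : set R).
Proof.
split; first by exists 0; rewrite // linear0.
- by move=> _ _ [x _ <-] [y _ <-]; exists (x + y); rewrite // linearD.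
- by move=> a _ [x _ <-]; exists (a *: x); rewrite // linearZ.
Qed.

Lemma prime_chain4 (p0 p1 p2 p3 : set R) :
  is_prime p0 -> is_prime p1 -> is_prime p2 -> is_prime p3 ->
  p0 `<` p1 -> p1 `<` p2 -> p2 `<` p3 ->
  prime_chain (fun i : 'I_4 => nth set0 [:: p0; p1; p2; p3] i).
Proof.
move=> h0 h1 h2 h3 h01 h12 h23.
have trans (a b c : set R) : a `<` b -> b `<` c -> a `<` c.
  move=> [ab nba] [bc _]; split; first exact: subset_trans bc.
  by move=> ca; apply: nba; apply: subset_trans ca.
have h02 := trans _ _ _ h01 h12; have h13 := trans _ _ _ h12 h23.
have h03 := trans _ _ _ h02 h23.
split=> [i|i j]; first by move: i => [[|[|[|[|i]]]] lti].
by move: i j => [[|[|[|[|i]]]] lti] [[|[|[|[|j]]]] ltj].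
Qed.

(** The condition for Q is applied with y f1 + c t as the constant. The term y f1 h(w) is then the
    value of f at (0, y h(w)). *)
Lemma stable_range_step (Q : lmodType R) : stable_range_condition Q ->
  stable_range_condition (Q * R^o)%type.
Proof.
move=> srQ f c [[v y] [t e]]; move: e; rewrite prod_linearE => e.
have linr : linear (fun x => f (x, 0)).
  by move=> r x z; rewrite -linearP; congr (f _); apply: inl_linear.
pose f1 : R := f (0, 1).
have [|h [w hw]] := srQ (mklin linr) (y * f1 + c * t).
  by exists v, 1; rewrite mulr1 addrA.
exists (t \*: (h \o (fst : {linear (Q * R^o)%type -> Q}))).
exists (w, y * h w); rewrite prod_linearE -[RHS]hw /= -/f1.
have r (F H : R) : F + y * H * f1 + c * (t * H) = F + (y * f1 + c * t) * H by ring.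
exact: r.
Qed.

Hypothesis noethR : noetherian R.
Hypothesis dimR : forall m (p : 'I_m.+1 -> set R), prime_chain p -> (m <= 2)%N.

Lemma stable_range_base (P : lmodType R) :
  (forall p, is_prime p -> rank_ge2_on P [:: p]) ->
  stable_range_condition (P * R^o)%type.
Proof.
move=> rk f a [v [t fv]].
have rkl l : (forall p, p \in l -> is_prime p) -> antichain l -> rank_ge2_on P l.
  by move=> lP ac; apply: rank_ge2_glue => // p /lP/rk.
have mulI (b : R) : is_ideal (range ( *%R b) : set R).
  split; first by exists 0; rewrite // mulr0.
  - by move=> _ _ [x _ <-] [y _ <-]; exists (x + y); rewrite // mulrDr.
  - by move=> c _ [x _ <-]; exists (c * x) => //; ring.
have linr : linear (fun x => f (x, 0)).
  by move=> r x y; rewrite -linearP; congr (f _); apply: inl_linear.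
pose f0 := mklin linr; pose f1 : R := f (0, 1).
have [l0 [l0P l0ac l0min]] := minimal_primes_away noethR a (mulI 0).
have [|g1 [g2 [v1 [v2 [s [g11 g12 g21 g22 l0s]]]]]] :=
  rank_ge2_dual (rkl l0 _ l0ac).
  by move=> p /l0P[].
(* The frame [g1], [g2] fails on V(s); there [h1], with value [s'] at [w1], takes over. *)
have [ls [lsP lsac lsmin]] := minimal_primes_away noethR a (mulI s).
have [|h1 [_ [w1 [_ [s' [h11 _ _ _ lss']]]]]] :=
  rank_ge2_dual (rkl ls _ lsac).
  by move=> p /lsP[].
(* First step: nonzero modulo the minimal primes of [s]. *)
have [|ta hta] := avoidance_mul (f0 w1) (b := a * s') _ lsac.
  move=> p pl; have [[pI p1 pM] _ pa] := lsP p pl; split=> // /pM[//|].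
  exact: lss'.
pose fa := f0 \+ a \*: (ta \*: h1).
(* Second step: the coordinate along [v1] avoids the minimal primes. The factor
   [s] protects the first step. *)
have [|tb htb] := avoidance_mul (fa v1) (b := a * (s * s)) _ l0ac.
  move=> p pl; have [[pI p1 pM] _ pa] := l0P p pl; split=> // /pM[//|/pM[]];
  exact: l0s.
pose fb := fa \+ a \*: ((s * tb) \*: g1).
(* Only primes avoiding s are listed, since the frame is valid there; primes over s are handled by
   the first step. *)
have [lc [lcP lcac lcmin]] := minimal_primes_away noethR (a * s) (mulI (fb v1)).
(* Third step: the coordinate along [v2] avoids the minimal primes of the first
   coordinate, which [g2] does not alter. *)
have [|tc htc] := avoidance_mul (fb v2) (b := a * (s * s)) _ lcac.
  move=> p pl; have [pp _ pas] := lcP p pl; split=> // pass.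
  have [pI p1 pM] := pp; move: pass; rewrite mulrA => /pM[//|ps].
  by apply: pas; have [_ _] := pI; apply.
pose fc := fb \+ a \*: ((s * tc) \*: g2).
(* Last step: the functional on P is settled, and f1 is moved off the minimal primes of its
   image. *)
have [ld [ldP ldac ldmin]] := minimal_primes_away noethR a (range_ideal fc).
have [|td htd] := avoidance_mul f1 (b := a) _ ldac.
  by move=> p /ldP[].
pose h : {linear (P * R^o)%type -> R^o} :=
  ((ta \*: h1 \+ (s * tb) \*: g1 \+ (s * tc) \*: g2) \o
    (fst : {linear (P * R^o)%type -> P})) \+
  td \*: (snd : {linear (P * R^o)%type -> R^o}).
exists h; apply: contrapT => nex.
have [|p pp sub] := proper_sub_prime noethR (range_ideal (f \+ a \*: h)).
  by move=> [w _ hw]; apply: nex; exists w.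
have [pI p1 pM] := pp; have [_ pD _] := pI.
have fcE x : (f (x, 0) : R) + a * h (x, 0) = fc x.
  rewrite /h /fc /fb /fa /=.
  have r (F A B C : R) : F + a * (A + B + C + td * 0) =
    F + a * A + a * B + a * C by ring.
  exact: r.
(* 1 = (f + a h) v + a (t - h v). *)
have pa : ~ p a.
  move=> pa; apply: p1; rewrite -fv addrC.
  apply: (ideal_addKr pI) (ideal_mulr (h v) pI pa); rewrite -addrA.
  by apply: pD; [apply: ideal_mulr | apply: sub; exists v].
have pfc : range fc `<=` p.
  by move=> _ [x _ <-]; rewrite -fcE; apply: sub; exists (x, 0).
have pf1 : p (f1 + a * td).
  apply: sub; exists (0, 1) => //=.
  rewrite !linear0.
  have r (F : R) : F + a * (0 + 0 + 0 + td * 1) = F + a * td by ring.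
  exact: r.
have [p3 p3l p3p] := ldmin p pp pfc pa.
have [pp3 p3fc p3a] := ldP p3 p3l.
have p3_lt : p3 `<` p by apply: proper_witness pf1 (htd _ p3l).
(* The chain q1 < q2 < p3 < p would have length 3, beyond the dimension. *)
suff [q1 [q2 [qp1 qp2 lt12 lt23]]] :
    exists q1 q2, [/\ is_prime q1, is_prime q2, q1 `<` q2 & q2 `<` p3].
  by have := dimR (prime_chain4 qp1 qp2 pp3 pp lt12 lt23 p3_lt).
have zero_sub (q : set R) : is_prime q -> range ( *%R (0 : R)) `<=` q.
  by move=> [[q0 _ _] _ _] _ [x _ <-]; rewrite mul0r.
have mul_sub (q : set R) (b : R) : is_prime q -> q b -> range ( *%R b) `<=` q.
  by move=> [qI _ _] qb _ [x _ <-]; apply: ideal_mulr.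
have [_ _ p3M] := pp3.
(* If s is in p3, let q2 be minimal over s: s separates q1 from q2, and [fc w1], unchanged modulo s
   since the first step, separates q2 from p3. Otherwise q2 is minimal over [fb v1], which separates
   q1 from q2, and [fc v2] separates q2 from p3. *)
case: (pselect (p3 s)) => p3s.
  have [q2 q2l q23] := lsmin p3 pp3 (mul_sub _ _ pp3 p3s) p3a.
  have [qp2 q2s q2a] := lsP q2 q2l.
  have {}q2s : q2 s by apply: q2s; exists 1; rewrite // mulr1.
  have [q1 q1l q12] := l0min q2 qp2 (zero_sub _ qp2) q2a.
  have [qp1 _ q1a] := l0P q1 q1l.
  exists q1, q2; split=> //; first exact: proper_witness q2s (l0s _ q1l).
  apply: (@proper_witness _ _ (fc w1)) => //; first by apply: p3fc; exists w1.
  have -> : (fc w1 : R) =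
      f0 w1 + a * s' * ta + s * (a * tb * g1 w1 + a * tc * g2 w1).
    rewrite /fc /fb /fa /= h11.
    have r (F A B : R) :
        F + a * (ta * s') + a * (s * tb * A) + a * (s * tc * B) =
      F + a * s' * ta + s * (a * tb * A + a * tc * B) by ring.
    exact: r.
  have [q2I _ _] := qp2.
  by move=> /(ideal_addKr q2I)/(_ (ideal_mulr _ q2I q2s)); apply: hta.
have p3b : p3 (fb v1).
  apply: p3fc; exists v1 => //; rewrite /fc /= g21 [_ *: 0]mulr0.
  by rewrite [_ *: 0]mulr0 addr0.
have p3as : ~ p3 (a * s) by move=> /p3M[].
have [q2 q2l q23] := lcmin p3 pp3 (mul_sub _ _ pp3 p3b) p3as.
have [qp2 q2b q2as] := lcP q2 q2l.
have {}q2b : q2 (fb v1) by apply: q2b; exists 1; rewrite // mulr1.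
have q2a : ~ q2 a.
  by move=> q2a; apply: q2as; apply: ideal_mulr => //; case: qp2.
have [q1 q1l q12] := l0min q2 qp2 (zero_sub _ qp2) q2a.
have [qp1 _ q1a] := l0P q1 q1l.
exists q1, q2; split=> //.
  apply: proper_witness q2b _ => //.
  have -> : (fb v1 : R) = fa v1 + a * (s * s) * tb; last exact: htb.
  rewrite /fb /= g11.
  have r (F : R) : F + a * (s * tb * s) = F + a * (s * s) * tb by ring.
  exact: r.
apply: (@proper_witness _ _ (fc v2)) => //; first by apply: p3fc; exists v2.
have -> : (fc v2 : R) = fb v2 + a * (s * s) * tc; last exact: htc.
rewrite /fc /= g22.
have r (F : R) : F + a * (s * tc * s) = F + a * (s * s) * tc by ring.
exact: r.
Qed.

End StableRange.

(** * Localization and the rank at a prime *)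

Section DualBasis.
Variables (R : comPzRingType) (P : lmodType R).

(** Projectivity splits the surjection R^n -> P given by the generators; the [h i] are the
    coordinates of the splitting. *)
Lemma dual_basis : finitely_generated P -> projective P ->
  exists n (g : 'I_n -> P) (h : 'I_n -> {linear P -> R^o}),
    forall x, x = \sum_i (h i x : R) *: g i.
Proof.
move=> [n [g gen]] projP.
have linf : linear (fun a : 'rV[R]_n => \sum_i a 0 i *: g i).
  move=> r a b; rewrite scaler_sumr -big_split; apply: eq_bigr => i _ /=.
  by rewrite !mxE scalerDl scalerA.
have [y|h hK] := projP _ _ (mklin linf) (idfun : {linear P -> P}).
  have [a ->] := gen y; exists (\row_i a i) => /=.
  by apply: eq_bigr => i _; rewrite mxE.
have linh i : linear (fun x => h x 0 i : R^o).
  by move=> r x y; rewrite linearP !mxE.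
exists n, g, (fun i => mklin (linh i)) => x.
by rewrite -[LHS](hK x).
Qed.

End DualBasis.

Section LocalRank.
Variables (R : comPzRingType) (p : set R) (hp : is_prime p).
Local Notation S := (prime_compl hp).
Local Notation Rp := (locring S).
Local Notation Mp M := (locmod S M).

Definition to_loc (M : lmodType R) (x : M) : Mp M := \pi_(Mp M) (x, den1 S).
Definition to_locring (r : R) : Rp := @to_loc R^o r.

Lemma to_locD (M : lmodType R) (x y : M) :
  to_loc (x + y) = to_loc x + to_loc y.
Proof.
rewrite /to_loc addlE; apply/eqP/locmodP; exists (den1 S).
by rewrite /addf /= !denME !den1E !scalerDr !mulr1 !scale1r.
Qed.

Lemma to_locZ (M : lmodType R) r (x : M) :
  to_loc (r *: x) = to_locring r *: to_loc x.
Proof.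
rewrite [RHS]actlE; apply/eqP/locmodP; exists (den1 S).
by rewrite /actf /= !denME !den1E !mulr1.
Qed.

Lemma to_loc_sum (M : lmodType R) n (F : 'I_n -> M) :
  to_loc (\sum_i F i) = \sum_i to_loc (F i).
Proof.
apply: (big_morph _ (@to_locD M)).
by apply/eqP/locmodP; exists (den1 S).
Qed.

Lemma to_locringM a b : to_locring (a * b) = to_locring a * to_locring b.
Proof. exact: (@to_locZ R^o). Qed.

Lemma to_locringB a b : to_locring (a - b) = to_locring a - to_locring b.
Proof.
apply: (addIr (to_locring b)); rewrite subrK.
by rewrite -[LHS](@to_locD R^o) [in LHS]subrK.
Qed.

Lemma loc_den (M : lmodType R) (x : M) (t : set_type S) :
  to_locring (den t) *: \pi_(Mp M) (x, t) = to_loc x.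
Proof.
rewrite [LHS]actlE; apply/eqP/locmodP; exists (den1 S).
by rewrite /actf /= !denME !den1E !mul1r scale1r.
Qed.

Definition max_loc : set Rp :=
  [set z | exists (r : R) (t : set_type S),
    p r /\ z = \pi_(Mp R^o) (r : R^o, t)].

Lemma max_locD x y : max_loc x -> max_loc y -> max_loc (x + y).
Proof.
have [[p0 pD pM] _ _] := hp.
move=> [a [s [pa ->]]] [b [t [pb ->]]]; rewrite addlE /addf /=.
exists (den t * a + den s * b), (denM s t); split=> //.
by apply: pD; apply: pM.
Qed.

Lemma max_locM x y : max_loc y -> max_loc (x * y).
Proof.
have [[p0 pD pM] _ _] := hp.
elim/quotW: x => -[a s]; move=> [b [t [pb ->]]].
rewrite [_ * _]actlE /actf /=.
by exists (a * b), (denM s t); split=> //; apply: pM.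
Qed.

Lemma max_loc0 : max_loc 0.
Proof. by have [[p0 _ _] _ _] := hp; exists 0, (den1 S). Qed.

Lemma max_loc_to_locring r : max_loc (to_locring r) -> p r.
Proof.
have [[p0 pD pM] p1 pP] := hp.
move=> [a [t [pa /eqP/locmodP[u /= e]]]].
have {}e : den u * den t * r = den u * den (den1 S) * a by [].
have : p (den u * den t * r) by rewrite e; apply: pM.
have nu := denP u; have nt := denP t.
by move=> /pP[/pP[]|].
Qed.

(** Clearing denominators in a basis of P_p gives v1, v2 in P whose coordinate matrix is diagonal
    with determinant t1 t2 outside p. As in the Cauchy-Binet formula, this determinant is a
    combination of minors of the [h k], so these are not all in p. *)
Lemma constant_rank_ge2 (P : lmodType R) :
  finitely_generated P -> projective P -> constant_rank P 2 ->
  rank_ge2_on P [:: p].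
Proof.
move=> fgP projP /(_ p hp)[f [f' fK f'K]].
have [n [g [h hE]]] := dual_basis fgP projP.
have linf' : linear f'.
  by move=> a x y; apply: (can_inj fK); rewrite linearP !f'K.
pose F := mklin linf'.
have basis (j : 'I_2) : exists (v : P) (t : set_type S),
    F (to_loc v) = to_locring (den t) *: delta_mx 0 j.
  have [[v t] e] : exists vt, f (delta_mx 0 j) = \pi_(Mp P) vt.
    by elim/quotW: (f _) => vt; exists vt.
  by exists v, t; rewrite -(loc_den v t) linearZ -e /= fK.
have [v1 [t1 b1]] := basis 0; have [v2 [t2 b2]] := basis 1.
pose c k i := F (to_loc (g k)) 0 i.
have coord x i : F (to_loc x) 0 i = \sum_k to_locring (h k x) * c k i.
  rewrite [in LHS](hE x) to_loc_sum linear_sum summxE; apply: eq_bigr => k _.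
  by rewrite to_locZ linearZ mxE.
apply: contrapT => nrk.
have minp k l : p (minor (h k) (h l) v1 v2).
  apply: contrapT => npm; apply: nrk; exists (h k), (h l), v1, v2 => q.
  by rewrite inE => /eqP ->.
have : max_loc (to_locring (den t1 * den t2)).
  have -> : to_locring (den t1 * den t2) =
      F (to_loc v1) 0 0 * F (to_loc v2) 0 1 -
      F (to_loc v2) 0 0 * F (to_loc v1) 0 1.
    rewrite to_locringM b1 b2 !mxE /=.
    by rewrite !(mulr0, mulr1) subr0.
  rewrite !coord !mulr_suml -sumrB.
  apply: (big_ind max_loc) => [||k _]; [exact: max_loc0|exact: max_locD|].
  rewrite !mulr_sumr -sumrB.
  apply: (big_ind max_loc) => [||l _]; [exact: max_loc0|exact: max_locD|].
  have -> : to_locring (h k v1) * c k 0 * (to_locring (h l v2) * c l 1) -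
      to_locring (h k v2) * c k 0 * (to_locring (h l v1) * c l 1) =
    c k 0 * c l 1 * to_locring (minor (h k) (h l) v1 v2).
    rewrite /minor to_locringB !to_locringM; ring.
  apply: max_locM; exists (minor (h k) (h l) v1 v2), (den1 S).
  by split.
move=> /max_loc_to_locring; have [_ _ pM] := hp.
by move=> /pM[]; [apply: (denP t1) | apply: (denP t2)].
Qed.

End LocalRank.

(** * Stabilization maps and the direct limit *)

Lemma elementary_group_sum (R : comPzRingType) (M N : lmodType R)
    (D : decomposition M) f :
  elementary_group D f -> elementary_group (decomp_add N D) (aut_sum N f).
Proof.
pose H : set (aut M) :=
  [set f | elementary_group (decomp_add N D) (aut_sum N f)].
suff sub : elementary_group D `<=` H by exact: sub.
apply: gen_min => [|{}f g hf hg|{}f [i [j [s [ij fE]]]]].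
- have -> : H 1%g = elementary_group (decomp_add N D) 1%g; last exact: gen1.
  by congr (elementary_group _ _); apply: aut_eqP => -[].
- rewrite /H /= aut_sumM; apply: genM => //.
  have -> : aut_sum N (g^-1)%g = ((aut_sum N g)^-1)%g; last exact: genV.
  by apply: aut_eqP => -[].
- apply: gen_sub; exists (Some i), (Some j), s; split=> // -[x y].
  by rewrite /= fE; congr pair; rewrite addr0.
Qed.

Section Main.
Variables (R : comPzRingType) (P0 : lmodType R).

Lemma stable_range_stab : noetherian R -> krull_dim R 2 ->
  finitely_generated P0 -> projective P0 -> constant_rank P0 2 ->
  forall k, stable_range_condition (stab P0 k.+1).
Proof.
move=> noethR [_ dimR] fgP projP rkP; elim=> [|k IHk].
  apply: stable_range_base => // p pp; exact: constant_rank_ge2.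
exact: stable_range_step.
Qed.

(** Descending from P_(k+3) to P_(k+2) takes the stable range condition for P_(k+1), available from
    P_3 on; hence the bound on k. *)
Lemma Estab_desc n k (f : aut (stab P0 k)) :
  (forall j, stable_range_condition (stab P0 j.+1)) -> (1 < k)%N ->
  let a := iter n (@stab_step R P0) (existT (fun k => aut (stab P0 k)) k f) in
  Estab P0 (tag a) (tagged a) -> Estab P0 k f.
Proof.
move=> sr; elim: n k f => // n IHn [|[|k]] // f _ a.
rewrite /a iterSr => Ef.
have := IHn k.+3 (aut_sum R^o f) isT Ef; rewrite !EstabS.
exact: (injective_stability (sr k)).
Qed.

Lemma Estab_asc n k (f : aut (stab P0 k)) :
  let a := iter n (@stab_step R P0) (existT (fun k => aut (stab P0 k)) k f) in
  Estab P0 k f -> Estab P0 (tag a) (tagged a).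
Proof.
by elim: n => // n IHn a Ef; apply: elementary_group_sum (IHn Ef).
Qed.

End Main.

Local Close Scope ring_scope.
Local Close Scope quotient_scope.

(* P_4 = P_0 (+) R e_3 (+) R e_4 is stab P0 2 *)
Theorem theorem2p15 (R : comPzRingType) (P0 : lmodType R) :
  regular_ring R ->
  krull_dim R 2 ->
  finitely_generated P0 ->
  projective P0 ->
  constant_rank P0 2 ->
  E_infty P0 `&` Aut_level P0 2 = E_level P0 2.
Proof.
move=> [noethR _] dimR fgP projP rkP.
have sr := stable_range_stab noethR dimR fgP projP rkP.
apply/seteqP; split; last first.
  move=> x Ex; split; first by exists 2%N.
  by case: Ex => f _ <-; exists f.
move=> x [[k _ [g Eg gx]] [f _ fx]]; exists f => //.
have /eqP := etrans gx (esym fx).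
(* Equality in the limit gives a common level at which g and f agree: membership in E goes up from g
   and comes down to f. *)
rewrite eqmodE => /asboolP[m [n e]].
apply: (@Estab_desc _ _ n) => //=; rewrite -e.
exact: Estab_asc.
Qed.
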